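(* For every $n\in\mathbb{N}$, $\mathcal{IOP}_n$ is an $\mathcal{H}$-cross-section of $\mathcal{IP}_n$.
   Context: Let $X$ be an arbitrary set and let $X'=\{x':x\in X\}$ be a disjoint copy of $X$, with $x\mapsto x'$ a fixed bijection $X\to X'$; the inverse bijection is also denoted by $'$, and $B'=\{x':x\in B\}$ for $B\subseteq X$. Let $\mathcal{CS}_X$ be the set of all partitions of $X\cup X'$ into nonempty blocks. For $a\in\mathcal{CS}_X$ write $x\equiv_a y$ if $x,y\in X\cup X'$ lie in the same block of $a$. The product $ab$ of $a,b\in\mathcal{CS}_X$ is the partition corresponding to the equivalence relation $\equiv$ on $X\cup X'$ defined, for $x,y\in X$, by: (i) $x\equiv y$ iff $x\equiv_a y$ or there are $s\ge 1$ and $c_1,\dots,c_{2s}\in X$ with $x\equiv_a c_1'$, $c_1\equiv_b c_2$, $c_2'\equiv_a c_3'$, $\dots$, $c_{2s-1}\equiv_b c_{2s}$, $c_{2s}'\equiv_a y$; (ii) $x'\equiv y'$ iff $x'\equiv_b y'$ or there are $s\ge 1$ and $c_1,\dots,c_{2s}\in X$ with $x'\equiv_b c_1$, $c_1'\equiv_a c_2'$, $c_2\equiv_b c_3$, $\dots$, $c_{2s-1}'\equiv_a c_{2s}'$, $c_{2s}\equiv_b y'$; (iii) $x\equiv y'$ iff $y'\equiv x$ iff there are $s\ge 1$ and $c_1,\dots,c_{2s-1}\in X$ with $x\equiv_a c_1'$, $c_1\equiv_b c_2$, $c_2'\equiv_a c_3'$, $\dots$, $c_{2s-2}'\equiv_a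 c_{2s-1}'$, $c_{2s-1}\equiv_b y'$. With this product $\mathcal{CS}_X$ is a semigroup, and $\mathcal{IP}_X$ is the subsemigroup (an inverse semigroup) of all $a\in\mathcal{CS}_X$ each of whose blocks meets both $X$ and $X'$. For $X=\{1,\dots,n\}$ write $\mathcal{IP}_n$. An element of $\mathcal{IP}_n$ is written $a=(A_i\cup B_i')_{i\in I}$, where the $A_i\cup B_i'$ are its blocks and $A_i,B_i\subseteq\{1,\dots,n\}$ are nonempty. For nonempty $A\subseteq\{1,\dots,n\}$ let $\min_A$ be the least element of $A$ in the natural order. $\mathcal{IOP}_n$ is the set of all $a=(A_i\cup B_i')_{i\in I}\in\mathcal{IP}_n$ such that for all $i,j\in I$: $\min_{A_i}\le\min_{A_j}$ implies $\min_{B_i}\le\min_{B_j}$. A subsemigroup $T$ of a semigroup $S$ is an $\mathcal{H}$-cross-section of $S$ if $T$ contains exactly one element from each $\mathcal{H}$-class of $S$, where $\mathcal{H}=\mathcal{R}\cap\mathcal{L}$ is Green's relation. *)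

(* Defs.v *)
From HB Require Import structures.
From mathcomp Require Import all_boot.
From mathcomp Require Import boolp.

Set Implicit Arguments.
Unset Strict Implicit.
Unset Printing Implicit Defensive.

Section Green.
Variable S : semigroupType.
Implicit Types a b x : S.

(* S^1 denotes S with an identity adjoined, whence the disjunct x = a. *)
Definition in_right_ideal a x : Prop := x = a \/ exists u, x = (a * u)%g.
Definition in_left_ideal a x : Prop := x = a \/ exists u, x = (u * a)%g.

Definition greenR a b : Prop :=
  forall x, in_right_ideal a x <-> in_right_ideal b x.
Definition greenL a b : Prop :=
  forall x, in_left_ideal a x <-> in_left_ideal b x.
Definition greenH a b : Prop := greenR a b /\ greenL a b.

Definition is_H_class (C : S -> Prop) : Prop :=
  exists a, forall x, C x <-> greenH a x.

Definition H_cross_section (T : {pred S}) : Prop :=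
  mulg_closed T /\
  forall C : S -> Prop, is_H_class C -> exists! t, t \in T /\ C t.

End Green.

Section CS.
Variable X : finType.

(* X \cup X' is the disjoint sum X + X: inl x is x and inr x is x'. *)
Record CS := MkCS {
  blocks : {set {set X + X}};
  blocksP : partition blocks [set: X + X] }.

HB.instance Definition _ := [isSub for blocks].
HB.instance Definition _ := [Choice of CS by <:].

Definition cs_rel (a : CS) (u v : X + X) : bool :=
  [exists B in blocks a, (u \in B) && (v \in B)].

Section Product.
Variables a b : CS.
Local Notation "u ~a v" := (cs_rel a u v) (at level 70).
Local Notation "u ~b v" := (cs_rel b u v) (at level 70).
Implicit Types (c : nat -> X) (x y : X).

(* Chains c_1, ..., c_2s (or c_1, ..., c_(2s-1)) are the values of
   c : nat -> X at the indices 1, ..., 2s; other values are irrelevant. *)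
Definition prod_top x y : Prop :=
  inl x ~a inl y \/
  exists s c, [/\ 0 < s,
    inl x ~a inr (c 1),
    forall i, 0 < i <= s -> inl (c i.*2.-1) ~b inl (c i.*2),
    forall i, 0 < i < s -> inr (c i.*2) ~a inr (c i.*2.+1) &
    inr (c s.*2) ~a inl y].

Definition prod_bot x y : Prop :=
  inr x ~b inr y \/
  exists s c, [/\ 0 < s,
    inr x ~b inl (c 1),
    forall i, 0 < i <= s -> inr (c i.*2.-1) ~a inr (c i.*2),
    forall i, 0 < i < s -> inl (c i.*2) ~b inl (c i.*2.+1) &
    inl (c s.*2) ~b inr y].

Definition prod_mix x y : Prop :=
  exists s c, [/\ 0 < s,
    inl x ~a inr (c 1),
    forall i, 0 < i < s -> inl (c i.*2.-1) ~b inl (c i.*2),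
    forall i, 0 < i < s -> inr (c i.*2) ~a inr (c i.*2.+1) &
    inl (c s.*2.-1) ~b inr y].

Definition prod_rel (u v : X + X) : bool :=
  match u, v with
  | inl x, inl y => `[< prod_top x y >]
  | inr x, inr y => `[< prod_bot x y >]
  | inl x, inr y => `[< prod_mix x y >]
  | inr y, inl x => `[< prod_mix x y >]
  end.

End Product.

Lemma cs_relE (a : CS) u v : cs_rel a u v = (v \in pblock (blocks a) u).
Proof.
case/and3P: (blocksP a) => /eqP cov tri _.
apply/exists_inP/idP => [[B aB /andP[uB vB]]|uv].
  by rewrite (def_pblock tri aB uB).
exists (pblock (blocks a) u); first by rewrite pblock_mem // cov inE.
by rewrite mem_pblock cov inE uv.
Qed.

Lemma cs_rel_equiv (a : CS) : equivalence_rel (cs_rel a).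
Proof.
move=> u v w; rewrite !cs_relE.
exact: (pblock_equivalence (blocksP a)); rewrite inE.
Qed.

Lemma cs_rel_refl (a : CS) u : cs_rel a u u.
Proof. by case: (cs_rel_equiv a u u u). Qed.

Lemma cs_rel_sym (a : CS) u v : cs_rel a u v = cs_rel a v u.
Proof.
have H x y : cs_rel a x y -> cs_rel a y x.
  by move=> xy; have [_ <-//] := cs_rel_equiv a x y x; exact: cs_rel_refl.
by apply/idP/idP; exact: H.
Qed.

Lemma cs_rel_trans (a : CS) v u w :
  cs_rel a u v -> cs_rel a v w -> cs_rel a u w.
Proof. by move=> uv vw; have [_ ->//] := cs_rel_equiv a u v w. Qed.

Lemma cs_eqP (a b : CS) : cs_rel a =2 cs_rel b -> a = b.
Proof.
move=> ab; apply: val_inj => /=.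
rewrite -(equivalence_partition_pblock (blocksP a)).
rewrite -(equivalence_partition_pblock (blocksP b)).
apply: eq_imset => u; apply/setP => v.
by rewrite !inE -!cs_relE ab.
Qed.

(* Two-colourings of X \cup X', constant on the blocks of a: they
   determine a and turn products into composition of relations. *)
Definition colour (g h : X -> bool) (u : X + X) : bool :=
  match u with inl x => g x | inr x => h x end.

Definition compat (a : CS) (g h : X -> bool) : Prop :=
  forall u v, cs_rel a u v -> colour g h u = colour g h v.


Lemma alternating_chain (A B : rel X) c d : reflexive A -> reflexive B ->
  connect (relU A B) c d -> exists s f, [/\ 0 < s, f 1 = c, f s.*2 = d,
    forall i, 0 < i <= s -> B (f i.*2.-1) (f i.*2) &
    forall i, 0 < i < s -> A (f i.*2) (f i.*2.+1)].
Proof.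
move=> rA rB /connectP[p]; elim: p c => [|e p IH] c /=.
  move=> _ ->; exists 1, (fun=> c); split=> // -[|[]].
case/andP => ce pe d_last; have [s [f [s0 f1 fd fB fA]]] := IH e pe d_last.
pose g i := if i is i'.+3 then f i'.+1
            else if i == 2 then (if A c e then c else e) else c.
exists s.+1, g; split=> //.
- by case: s s0 fd {fB fA}.
- case=> [|[|i]] //= Hi; last exact: (fB i.+1).
  by case: ifP => [_|Ace]; [exact: rB|move: ce; rewrite Ace].
- case=> [|[|i]] //= Hi; last exact: (fA i.+1).
  by rewrite f1; case: ifP => [//|_]; exact: rA.
Qed.

Lemma chain_connect (A B : rel X) f s :
  (forall i, 0 < i <= s -> B (f i.*2.-1) (f i.*2)) ->
  (forall i, 0 < i < s -> A (f i.*2) (f i.*2.+1)) ->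
  0 < s -> connect (relU A B) (f 1) (f s.*2).
Proof.
move=> fB fA; elim: s fB fA => // s IH fB fA _.
have last_step : connect (relU A B) (f s.*2.+1) (f s.+1.*2).
  by apply: connect1; rewrite /= (fB s.+1) ?leqnn ?orbT.
have [s0|s0] := posnP s; first by rewrite s0 in last_step *.
apply: connect_trans last_step; apply: (@connect_trans _ _ (f s.*2)).
  apply: IH => // i /andP[i0 si]; first by apply: fB; rewrite i0 leqW.
  by apply: (fA i); rewrite i0 ltnW.
by apply: connect1; rewrite /= fA // s0 leqnn.
Qed.

Lemma chain_connect_odd (A B : rel X) f s :
  (forall i, 0 < i < s -> B (f i.*2.-1) (f i.*2)) ->
  (forall i, 0 < i < s -> A (f i.*2) (f i.*2.+1)) ->
  0 < s -> connect (relU A B) (f 1) (f s.*2.-1).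
Proof.
case: s => [//|s] fB fA _; have [->|s0] := posnP s; first exact: connect0.
apply: (@connect_trans _ _ (f s.*2)).
  apply: (@chain_connect A B) => // i /andP[i0 si].
  by apply: (fA i); rewrite i0 ltnW.
by apply: connect1; rewrite /= fA // s0 leqnn.
Qed.

Section ProductEquivalence.
Variables a b : CS.

Local Notation A := (relpre inr (cs_rel a)).
Local Notation B := (relpre inl (cs_rel b)).
Local Notation K := (connect (relU A B)).

Let rA : reflexive A. Proof. by move=> x; exact: cs_rel_refl. Qed.
Let rB : reflexive B. Proof. by move=> x; exact: cs_rel_refl. Qed.

Lemma midC : symmetric K.
Proof.
by apply: sym_connect_sym => c d; rewrite /= cs_rel_sym [cs_rel b _ _]cs_rel_sym.
Qed.

Lemma prod_topP x y : prod_top a b x y <->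
  cs_rel a (inl x) (inl y) \/ exists c d,
  [/\ cs_rel a (inl x) (inr c), K c d & cs_rel a (inr d) (inl y)].
Proof.
split=> -[xy|H]; [by left|right|by left|right].
  case: H => s [c [s0 xc cB cA cy]]; exists (c 1), (c s.*2); split=> //.
  exact: chain_connect.
case: H => c [d [xc cd dy]].
have [s [f [s0 f1 fd fB fA]]] := alternating_chain rA rB cd.
by exists s, f; split=> //; rewrite ?f1 ?fd.
Qed.

Lemma prod_botP x y : prod_bot a b x y <->
  cs_rel b (inr x) (inr y) \/ exists c d,
  [/\ cs_rel b (inr x) (inl c), K c d & cs_rel b (inl d) (inr y)].
Proof.
have eK : connect (relU B A) =2 K.
  by apply: eq_connect => c d; rewrite /= orbC.
split=> -[xy|H]; [by left|right|by left|right].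
  case: H => s [c [s0 xc cB cA cy]]; exists (c 1), (c s.*2); split=> //.
  by rewrite -eK; exact: chain_connect.
case: H => c [d [xc]]; rewrite -eK => cd dy.
have [s [f [s0 f1 fd fB fA]]] := alternating_chain rB rA cd.
by exists s, f; split=> //; rewrite ?f1 ?fd.
Qed.

Lemma prod_mixP x y : prod_mix a b x y <-> exists c d,
  [/\ cs_rel a (inl x) (inr c), K c d & cs_rel b (inl d) (inr y)].
Proof.
split=> [[s [c [s0 xc cB cA cy]]]|[c [d [xc cd dy]]]].
  exists (c 1), (c s.*2.-1); split=> //; exact: chain_connect_odd.
have [s [f [s0 f1 fd fB fA]]] := alternating_chain rA rB cd.
exists s.+1, (fun i => if i <= s.*2 then f i else d).
have dl i : 0 < i < s.+1 -> (i.*2.-1 <= s.*2) * (i.*2 <= s.*2).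
  by case/andP=> _; rewrite ltnS -leq_double => h; rewrite h (leq_trans (leq_pred _)).
split=> //=.
- by rewrite double_gt0 s0 f1.
- by move=> i ib; rewrite !dl //; exact: (fB i).
- move=> i ib; rewrite dl // ltn_double; case: ltnP => si.
    by apply: (fA i); case/andP: ib => ->.
  have -> : i = s by apply/eqP; rewrite eqn_leq si andbT; case/andP: ib.
  by rewrite fd cs_rel_refl.
- by rewrite ltnn.
Qed.

Definition attached (u : X + X) (c : X) : bool :=
  match u with
  | inl x => cs_rel a (inl x) (inr c)
  | inr y => cs_rel b (inl c) (inr y)
  end.

Definition direct (u v : X + X) : bool :=
  match u, v with
  | inl _, inl _ => cs_rel a u v
  | inr _, inr _ => cs_rel b u v
  | _, _ => false
  end.

Lemma prod_relP u v : prod_rel a b u v <->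
  direct u v \/ exists c d, [/\ attached u c, K c d & attached v d].
Proof.
have symA := cs_rel_sym a; have symB := cs_rel_sym b.
case: u v => [x|x] [y|y] /=; split.
- move=> /asboolP/prod_topP[|[c [d []]]]; first by left.
  by right; exists c, d; rewrite [cs_rel a (inl y) _]symA.
- move=> h; apply/asboolP/prod_topP; case: h => [|[c [d []]]]; first by left.
  by right; exists c, d; rewrite [cs_rel a (inr d) _]symA.
- by move=> /asboolP/prod_mixP; right.
- by move=> [//|h]; exact/asboolP/prod_mixP.
- move=> /asboolP/prod_mixP[c [d [h1 h2 h3]]].
  by right; exists d, c; rewrite midC.
- move=> [//|[c [d [h1 h2 h3]]]]; apply/asboolP/prod_mixP.
  by exists d, c; rewrite midC.
- move=> /asboolP/prod_botP[|[c [d [h1 h2 h3]]]]; first by left.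
  by right; exists c, d; rewrite symB.
- move=> h; apply/asboolP/prod_botP; case: h => [|[c [d [h1 h2 h3]]]].
    by left.
  by right; exists c, d; rewrite symB.
Qed.

Lemma direct_refl u : direct u u.
Proof. by case: u => x; exact: cs_rel_refl. Qed.

Lemma direct_sym u v : direct u v = direct v u.
Proof. by case: u v => [x|x] [y|y] //=; rewrite cs_rel_sym. Qed.

Lemma direct_trans v u w : direct u v -> direct v w -> direct u w.
Proof. by case: u v w => [x|x] [y|y] [z|z] //=; exact: cs_rel_trans. Qed.

Lemma attached_direct v u c : direct u v -> attached v c -> attached u c.
Proof.
case: u v => [x|x] [y|y] //=; first exact: cs_rel_trans.
by rewrite cs_rel_sym => yx cy; exact: cs_rel_trans cy yx.
Qed.

Lemma attached_mid u c d : attached u c -> attached u d -> K c d.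
Proof.
case: u => x /= h1 h2; apply: connect1 => /=; apply/orP.
  by left; apply: cs_rel_trans h2; rewrite cs_rel_sym.
by right; apply: (cs_rel_trans h1); rewrite cs_rel_sym.
Qed.

Lemma prod_rel_refl u : prod_rel a b u u.
Proof. by apply/prod_relP; left; exact: direct_refl. Qed.

Lemma prod_rel_sym u v : prod_rel a b u v -> prod_rel a b v u.
Proof.
move=> /prod_relP h; apply/prod_relP; rewrite direct_sym.
by case: h => [|[c [d [h1 h2 h3]]]]; [left|right; exists d, c; rewrite midC].
Qed.

Lemma prod_rel_trans v u w :
  prod_rel a b u v -> prod_rel a b v w -> prod_rel a b u w.
Proof.
move=> /prod_relP uv /prod_relP vw; apply/prod_relP.
case: uv vw => [uv|[c [d [uc cd vd]]]] [vw|[c' [d' [vc cd' wd]]]].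
- by left; exact: direct_trans uv vw.
- by right; exists c', d'; split=> //; exact: attached_direct vc.
- right; exists c, d; split=> //.
  by apply: attached_direct vd; rewrite direct_sym.
- right; exists c, d'; split=> //; apply: connect_trans cd _.
  exact: connect_trans (attached_mid vd vc) cd'.
Qed.

Lemma prod_rel_equiv :
  {in [set: X + X] & &, equivalence_rel (prod_rel a b)}.
Proof.
move=> u v w _ _ _; split=> [|uv]; first exact: prod_rel_refl.
apply/idP/idP; last exact: prod_rel_trans uv.
exact/prod_rel_trans/prod_rel_sym.
Qed.

Definition cs_mul : CS := MkCS (equivalence_partitionP prod_rel_equiv).

Lemma cs_mulE u v : cs_rel cs_mul u v = prod_rel a b u v.
Proof.
by rewrite cs_relE (pblock_equivalence_partition prod_rel_equiv) // inE.
Qed.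

Lemma compat_mul g0 g2 :
  compat cs_mul g0 g2 <-> exists g1, compat a g0 g1 /\ compat b g1 g2.
Proof.
split=> [g02|[g1 [g01 g12]] u v]; last first.
  have gK c d : K c d -> g1 c = g1 d.
    move=> /connectP[p]; elim: p c => [|e p IH] c /=; first by move=> _ ->.
    case/andP=> ce /IH ed /ed <-.
    by case/orP: ce => [/g01|/g12].
  have gatt w c : attached w c -> colour g0 g2 w = g1 c.
    by case: w => x; [move/g01|move/g12=> /=].
  rewrite cs_mulE => /prod_relP[|[c [d [uc cd vd]]]].
    by case: u v => [x|x] [y|y] //=; [move/g01|move/g12].
  by rewrite (gatt _ _ uc) (gatt _ _ vd) (gK _ _ cd).
pose g1 d := [exists u, [exists c,
  [&& attached u c, K c d & colour g0 g2 u]]].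
have g1P d : reflect
    (exists u c, [/\ attached u c, K c d & colour g0 g2 u]) (g1 d).
  apply: (iffP existsP) => -[u].
    by case/existsP=> c /and3P[? ? ?]; exists u, c.
  by case=> c [? ? ?]; exists u; apply/existsP; exists c; apply/and3P.
have g02P u v : prod_rel a b u v -> colour g0 g2 u = colour g0 g2 v.
  by rewrite -cs_mulE; exact: g02.
have gK c d : K c d -> g1 c = g1 d.
  have h c' d' : K c' d' -> g1 c' -> g1 d'.
    move=> cd /g1P[u [e [ue ec gu]]]; apply/g1P; exists u, e; split=> //.
    exact: connect_trans ec cd.
  by move=> cd; apply/idP/idP; apply: h; rewrite // midC.
have gatt w c : attached w c -> colour g0 g2 w = g1 c.
  move=> wc; apply/idP/g1P => [gw|[u [d [ud dc gu]]]].
    by exists w, c; split=> //; exact: connect0.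
  rewrite -(g02P u) //; apply/prod_relP; right.
  by exists d, c.
have gdir u v : direct u v -> colour g0 g2 u = colour g0 g2 v.
  by move=> uv; apply: g02P; apply/prod_relP; left.
exists g1; split=> -[x|x] [y|y] /= h.
- exact: (gdir (inl x) (inl y)).
- exact: (gatt (inl x)).
- by apply/esym/(gatt (inl y)); rewrite /= cs_rel_sym.
- by apply/gK/connect1; rewrite /= h.
- by apply/gK/connect1; rewrite /= h orbT.
- exact/esym/(gatt (inr y)).
- by apply: (gatt (inr x)); rewrite /= cs_rel_sym.
- exact: (gdir (inr x) (inr y)).
Qed.

End ProductEquivalence.

Lemma cs_compatP (a b : CS) :
  (forall g h, compat a g h <-> compat b g h) -> a = b.
Proof.
have half c d : (forall g h, compat c g h -> compat d g h) ->
    forall u v, cs_rel d u v -> cs_rel c u v.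
  move=> cd u v duv.
  pose g x := cs_rel c u (inl x); pose h x := cs_rel c u (inr x).
  have colE w : colour g h w = cs_rel c u w by case: w.
  have cgh : compat c g h.
    move=> w z wz; rewrite !colE.
    apply/idP/idP => uw; first exact: cs_rel_trans uw wz.
    by apply: cs_rel_trans uw _; rewrite cs_rel_sym.
  by have := cd _ _ cgh _ _ duv; rewrite !colE cs_rel_refl => <-.
by move=> ab; apply: cs_eqP => u v; apply/idP/idP; apply: half => g h /ab.
Qed.

Lemma cs_mulA : associative cs_mul.
Proof.
move=> a b c; apply: cs_compatP => g0 g3; rewrite !compat_mul; split.
  case=> g1 [a01 /compat_mul[g2 [b12 c23]]].
  by exists g2; split=> //; apply/compat_mul; exists g1.
case=> g2 [/compat_mul[g1 [a01 b12]] c23].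
by exists g1; split=> //; apply/compat_mul; exists g2.
Qed.

HB.instance Definition _ := isSemigroup.Build CS cs_mulA.

Definition is_IP : pred CS := fun a =>
  [forall B in blocks a, [exists x, inl x \in B] && [exists y, inr y \in B]].

Lemma is_IPP (a : CS) : reflect
  ((forall x, exists y, cs_rel a (inl x) (inr y)) /\
   (forall y, exists x, cs_rel a (inl x) (inr y)))
  (is_IP a).
Proof.
have relB B u v : B \in blocks a -> u \in B -> (v \in B) = cs_rel a u v.
  move=> aB uB; case/and3P: (blocksP a) => _ tri _.
  by rewrite cs_relE (def_pblock tri aB uB).
have blk u : exists2 B, B \in blocks a & u \in B.
  by have /exists_inP[B aB /andP[uB _]] := cs_rel_refl a u; exists B.
apply: (iffP forall_inP) => [h|[h1 h2] B aB].
  split=> z.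
    have [B aB zB] := blk (inl z).
    have /andP[_ /existsP[y yB]] := h B aB.
    by exists y; rewrite -(relB B).
  have [B aB zB] := blk (inr z).
  have /andP[/existsP[x xB] _] := h B aB.
  by exists x; rewrite -(relB B).
have /set0Pn[[x|y] uB] : B != set0.
- by case/and3P: (blocksP a) => _ _; apply: contraNneq => <-.
- have [y xy] := h1 x; apply/andP; split; apply/existsP; first by exists x.
  by exists y; rewrite (relB _ _ _ aB uB).
- have [x xy] := h2 y; apply/andP; split; apply/existsP; last by exists y.
  by exists x; rewrite (relB _ _ _ aB uB) cs_rel_sym.
Qed.

Lemma is_IP_mul : mulg_closed is_IP.
Proof.
move=> a b /is_IPP[a1 a2] /is_IPP[b1 b2]; apply/is_IPP.
have step x c y : cs_rel a (inl x) (inr c) -> cs_rel b (inl c) (inr y) ->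
    cs_rel (a * b)%g (inl x) (inr y).
  move=> xc cy; rewrite cs_mulE; apply/prod_relP; right.
  by exists c, c; split=> //; exact: connect0.
split=> z.
  have [c zc] := a1 z; have [y cy] := b1 c; exists y; exact: step cy.
have [c cz] := b2 z; have [x xc] := a2 c; exists x; exact: step cz.
Qed.

Record IP := MkIP { cs_of_IP :> CS; cs_of_IPP : is_IP cs_of_IP }.

HB.instance Definition _ := [isSub for cs_of_IP].
HB.instance Definition _ := [Choice of IP by <:].
HB.instance Definition _ := SubChoice_isSubSemigroup.Build CS is_IP IP is_IP_mul.

End CS.

(* {1, ..., n} is 'I_n = {0, ..., n-1}. The value n for the empty set is junk:
   the parts below are nonempty. *)
Definition min_of n (A : {set 'I_n}) : nat := \big[minn/n]_(i in A) i.

Definition upper_part n (B : {set 'I_n + 'I_n}) : {set 'I_n} :=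
  [set x | inl x \in B].
Definition lower_part n (B : {set 'I_n + 'I_n}) : {set 'I_n} :=
  [set x | inr x \in B].

Definition IOP n : {pred IP 'I_n} :=
  [pred a : IP 'I_n |
    [forall B in blocks a, [forall C in blocks a,
      (min_of (upper_part B) <= min_of (upper_part C)) ==>
      (min_of (lower_part B) <= min_of (lower_part C))]]].

Lemma min_ofP n (A : {set 'I_n}) : A != set0 ->
  exists2 m, m \in A & min_of A = m /\ forall x, x \in A -> m <= x.
Proof.
case/set0Pn=> x0 x0A.
have le_min x : x \in A -> min_of A <= x.
  move=> xA; have : x \in index_enum 'I_n by rewrite mem_index_enum.
  rewrite /min_of; elim: (index_enum _) => //= i r IH; rewrite inE big_cons.
  case/orP => [/eqP<-|/IH le_x]; first by rewrite xA geq_minl.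
  by case: ifP => // _; rewrite geq_min le_x orbT.
have [minn_|[m mA min_m]] : min_of A = n \/ exists2 m, m \in A & min_of A = m.
- rewrite /min_of; elim/big_ind: _ => [|p q hp hq|m mA]; first by left.
    by rewrite /minn; case: ifP.
  by right; exists m.
- by have := le_min x0 x0A; rewrite minn_ leqNgt ltn_ord.
- by exists m => //; split=> // x /le_min; rewrite min_m.
Qed.

Arguments IOP : clear implicits.

(* Main.v *)
(* Two elements of IP_X are R-related (L-related) iff their restrictions to X
   (to X') coincide, because a (a^-1 b) = b for such a and b, where a^-1 is
   the mirror image of a. So an H-class consists of all matchings between the
   upper and the lower parts of a given element, and it contains exactly one
   order-preserving matching: the one pairing parts of equal rank in the order
   of their minima. Products stay order-preserving because every block
   of ab is obtained by gluing a union of blocks of a to a union of blocks of b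
   along a subset of the middle copy of X, and order preservation extends from
   blocks to such unions. *)
Require Import Defs.
From mathcomp Require Import all_boot.

Set Implicit Arguments.
Unset Strict Implicit.
Unset Printing Implicit Defensive.

(** * Partitions as kernels of maps *)

Section KernelPartition.
Variables (X : finType) (T : eqType) (f : X + X -> T).

Definition cs_kernel : CS X := MkCS (preim_partitionP f [set: X + X]).

Lemma cs_kernelE u v : cs_rel cs_kernel u v = (f u == f v).
Proof.
rewrite cs_relE pblock_equivalence_partition ?inE //.
by move=> x y z _ _ _; split=> // /eqP->.
Qed.

End KernelPartition.

(** * The mirror image as inverse *)

Section Inverse.
Variable X : finType.
Implicit Types a b : CS X.

Definition swap (u : X + X) : X + X :=
  match u with inl x => inr x | inr x => inl x end.

Definition cs_inv a : CS X := cs_kernel (fun u => pblock (blocks a) (swap u)).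

Lemma cs_rel_pblock a u v :
  cs_rel a u v = (pblock (blocks a) u == pblock (blocks a) v).
Proof.
case/and3P: (blocksP a) => /eqP cov tri _.
by rewrite cs_relE eq_pblock // cov inE.
Qed.

Lemma cs_invE a u v : cs_rel (cs_inv a) u v = cs_rel a (swap u) (swap v).
Proof. by rewrite cs_kernelE cs_rel_pblock. Qed.

Lemma compat_inv a g h : compat (cs_inv a) g h <-> compat a h g.
Proof.
split=> gh u v.
  have := gh (swap u) (swap v); rewrite cs_invE.
  by case: u v => [x|x] [y|y].
by rewrite cs_invE => /gh; case: u v => [x|x] [y|y].
Qed.

Lemma is_IP_inv a : is_IP a -> is_IP (cs_inv a).
Proof.
case/is_IPP=> a1 a2; apply/is_IPP; split=> z.
  by have [x xz] := a2 z; exists x; rewrite cs_invE cs_rel_sym.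
by have [x xz] := a1 z; exists x; rewrite cs_invE cs_rel_sym.
Qed.

(** Give [y] the colour of any upper point of its block: the choice is immaterial because [g] is
    constant on upper parts. *)
Lemma compat_extend_lower a (g : X -> bool) :
  (forall x y, cs_rel a (inl x) (inl y) -> g x = g y) ->
  (forall x, exists y, cs_rel a (inl x) (inr y)) ->
  exists h, compat a g h.
Proof.
move=> ga aX; pose h y := [exists x, cs_rel a (inl x) (inr y) && g x].
have gh x y : cs_rel a (inl x) (inr y) -> g x = h y.
  move=> xy; apply/idP/existsP => [gx|[z /andP[zy gz]]].
    by exists x; rewrite xy.
  rewrite (ga x z) //; apply: (cs_rel_trans xy).
  by rewrite cs_rel_sym.
exists h => -[x|x] [y|y] /= xy.
- exact: ga.
- exact: gh.
- by apply/esym/gh; rewrite cs_rel_sym.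
- apply: eq_existsb => z; congr (_ && _).
  apply/idP/idP => h1; apply: cs_rel_trans h1 _ => //.
  by rewrite cs_rel_sym.
Qed.

Lemma compat_upper_uniq a g g' h :
  (forall x, exists y, cs_rel a (inl x) (inr y)) ->
  compat a g h -> compat a g' h -> g =1 g'.
Proof.
move=> aX gh g'h x; have [y xy] := aX x.
by rewrite [g x](gh _ _ xy) [g' x](g'h _ _ xy).
Qed.

Lemma eq_compat a g g' h h' : g =1 g' -> h =1 h' ->
  compat a g h -> compat a g' h'.
Proof.
by move=> gg hh gh u v /gh; case: u v => [x|x] [y|y] /=; rewrite ?gg ?hh.
Qed.

(** A colouring of the left side passes through the layers [g0], [g1], [g2], [g3], where [g0] and
    [g2] are both matched to [g1] by [a], hence equal. Conversely, a colouring [g0] fitting [b]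
    extends to some [g1] through [a], as both restrict alike to the upper copy. *)
Lemma cs_mulKV a b : is_IP a ->
  (forall x y, cs_rel a (inl x) (inl y) = cs_rel b (inl x) (inl y)) ->
  (a * (cs_inv a * b))%g = b.
Proof.
case/is_IPP=> a1 _ ab; apply: cs_compatP => g0 g3; split.
  case/compat_mul=> g1 [a01 /compat_mul[g2 [/compat_inv a21 b23]]].
  by apply: eq_compat b23 => //; exact: compat_upper_uniq a21 a01.
move=> b03; have [|g1 a01] := @compat_extend_lower a g0 _ a1.
  by move=> x y; rewrite ab => /b03.
apply/compat_mul; exists g1; split=> //.
by apply/compat_mul; exists g0; split=> //; apply/compat_inv.
Qed.

Lemma cs_invM a b : cs_inv (a * b)%g = (cs_inv b * cs_inv a)%g.
Proof.
apply: cs_compatP => g h; rewrite compat_inv !compat_mul.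
by split=> -[g1 [/compat_inv ? /compat_inv ?]]; exists g1.
Qed.

Lemma cs_invK a : cs_inv (cs_inv a) = a.
Proof. by apply: cs_compatP => g h; rewrite !compat_inv. Qed.

(** The involution [cs_inv] reverses products and turns this into [cs_mulKV]. *)
Lemma cs_mulVK a b : is_IP a ->
  (forall x y, cs_rel a (inr x) (inr y) = cs_rel b (inr x) (inr y)) ->
  (b * cs_inv a * a)%g = b.
Proof.
move=> aIP ab; apply: (can_inj cs_invK); rewrite !cs_invM.
apply: cs_mulKV; first exact: is_IP_inv.
by move=> x y; rewrite !cs_invE ab.
Qed.

End Inverse.

(** * Green's relations R and L as equality of restrictions *)

Section GreenIP.
Variable X : finType.
Implicit Types a b : IP X.

(** Right multiplication can only coarsen the restriction to the upper copy, so elements generating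
    the same right ideal restrict alike. The converse takes its right factor from [cs_mulKV]. *)
Lemma greenR_IP a b : greenR a b <->
  forall x y, cs_rel a (inl x) (inl y) = cs_rel b (inl x) (inl y).
Proof.
have sub (c d : IP X) : in_right_ideal c d ->
    forall x y, cs_rel c (inl x) (inl y) -> cs_rel d (inl x) (inl y).
  by case=> [->//|[e ->] x y cxy]; rewrite cs_mulE; apply/prod_relP; left.
have ideal (c d : IP X) :
    (forall x y, cs_rel c (inl x) (inl y) = cs_rel d (inl x) (inl y)) ->
    forall x, in_right_ideal d x -> in_right_ideal c x.
  move=> cd x dx; have [e de] : exists e, d = (c * e)%g.
    exists (MkIP (is_IP_inv (cs_of_IPP c)) * d)%g; apply: val_inj => /=.
    by rewrite [RHS]cs_mulKV //; exact: cs_of_IPP.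
  right; case: dx => [->|[w ->]]; first by exists e.
  by exists (e * w)%g; rewrite de mulgA.
split=> [ab x y|ab x]; last by split; apply: ideal => *; rewrite ab.
apply/idP/idP; apply: sub.
  by apply/ab; left.
by apply/ab; left.
Qed.

Lemma greenL_IP a b : greenL a b <->
  forall x y, cs_rel a (inr x) (inr y) = cs_rel b (inr x) (inr y).
Proof.
have sub (c d : IP X) : in_left_ideal c d ->
    forall x y, cs_rel c (inr x) (inr y) -> cs_rel d (inr x) (inr y).
  by case=> [->//|[e ->] x y cxy]; rewrite cs_mulE; apply/prod_relP; left.
have ideal (c d : IP X) :
    (forall x y, cs_rel c (inr x) (inr y) = cs_rel d (inr x) (inr y)) ->
    forall x, in_left_ideal d x -> in_left_ideal c x.
  move=> cd x dx; have [e de] : exists e, d = (e * c)%g.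
    exists (d * MkIP (is_IP_inv (cs_of_IPP c)))%g; apply: val_inj => /=.
    by rewrite [RHS]cs_mulVK //; exact: cs_of_IPP.
  right; case: dx => [->|[w ->]]; first by exists e.
  by exists (w * e)%g; rewrite de mulgA.
split=> [ab x y|ab x]; last by split; apply: ideal => *; rewrite ab.
apply/idP/idP; apply: sub.
  by apply/ab; left.
by apply/ab; left.
Qed.

End GreenIP.

(** * Minima of blocks and their ranks *)

Section BlockMinima.
Variable n : nat.
Implicit Types (a b : CS 'I_n) (i : 'I_n -> 'I_n + 'I_n) (u v : 'I_n + 'I_n).

(* i is one of the two embeddings inl and inr: bmin a inl u and bmin a inr u
   are min_A and min_B for the block A \cup B' containing u. *)
Definition bmin a i u : nat := min_of (i @^-1: pblock (blocks a) u).

Definition meets a i : Prop := forall u, exists z, cs_rel a u (i z).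

(** Each block is represented by its minimum on side [i], a fixed point of [bmin]. This is thus the
    rank, from 0, of the block of [u] when blocks are ordered by these minima. *)
Definition brank a i u : nat :=
  #|[set z : 'I_n | (bmin a i (i z) == z) && (z < bmin a i u)]|.

Lemma IP_meets a : is_IP a -> meets a inl /\ meets a inr.
Proof.
case/is_IPP=> a1 a2; split=> -[x|x].
- by exists x; exact: cs_rel_refl.
- by have [y xy] := a2 x; exists y; rewrite cs_rel_sym.
- exact: a1.
- by exists x; exact: cs_rel_refl.
Qed.

Lemma bminP a i u : meets a i ->
  exists z : 'I_n, [/\ bmin a i u = z, cs_rel a u (i z) &
    forall w, cs_rel a u (i w) -> z <= w].
Proof.
move=> ai; rewrite /bmin.
(* Nonemptiness from [meets] excludes the default value [n] of [min_of]. *)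
have [|z zA [-> zmin]] := @min_ofP n (i @^-1: pblock (blocks a) u).
  by have [z uz] := ai u; apply/set0Pn; exists z; rewrite inE -cs_relE.
exists z; split=> //; first by rewrite cs_relE; rewrite inE in zA.
by move=> w uw; apply: zmin; rewrite inE -cs_relE.
Qed.

(** A minimum lies in its block and blocks are disjoint, so it identifies the block. *)
Lemma bmin_eq a i u v : meets a i -> (bmin a i u == bmin a i v) = cs_rel a u v.
Proof.
move=> ai; apply/eqP/idP => [uv|]; last first.
  by rewrite cs_rel_pblock /bmin => /eqP->.
have [z [uz az _]] := bminP u ai; have [w [vw aw _]] := bminP v ai.
have zw : z = w by apply: val_inj; rewrite /= -uz -vw.
by apply: cs_rel_trans az _; rewrite zw cs_rel_sym.
Qed.

Lemma bmin_min a i u (z : 'I_n) : meets a i -> bmin a i u = z ->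
  bmin a i (i z) = z.
Proof.
move=> ai uz; have [w [uw aw _]] := bminP u ai.
have <- : w = z by apply: val_inj; rewrite /= -uw.
by rewrite -uw; apply/eqP; rewrite bmin_eq // cs_rel_sym.
Qed.

Lemma brank_lt a i u v : meets a i -> bmin a i u < bmin a i v ->
  brank a i u < brank a i v.
Proof.
move=> ai uv; have [z [uz _ _]] := bminP u ai.
apply/proper_card/properP; split.
  by apply/subsetP => w; rewrite !inE => /andP[-> wu]; exact: ltn_trans uv.
(* The minimum of the block of [u] is counted for [v] but not for [u]. *)
exists z; rewrite !inE -uz ?ltnn ?andbF // uv andbT.
by rewrite uz (bmin_min ai uz).
Qed.

Lemma brank_le a i u v : meets a i ->
  (brank a i u <= brank a i v) = (bmin a i u <= bmin a i v).
Proof.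
move=> ai; case: (ltngtP (bmin a i u) (bmin a i v)) => [lt|gt|eq].
- by rewrite ltnW ?brank_lt.
- by apply/negbTE; rewrite -ltnNge brank_lt.
- by rewrite /brank eq leqnn.
Qed.

Lemma brank_eq a i u v : meets a i ->
  (brank a i u == brank a i v) = cs_rel a u v.
Proof. by move=> ai; rewrite eqn_leq !brank_le // -eqn_leq bmin_eq. Qed.

(** Sending a minimum to its block is a bijection. Counting blocks instead of points makes ranks on
    the two sides comparable. *)
Lemma card_minima a i (P : pred nat) : meets a i ->
  #|[set z : 'I_n | (bmin a i (i z) == z) && P z]| =
  #|[set B in blocks a | P (min_of (i @^-1: B))]|.
Proof.
move=> ai; case/and3P: (blocksP a) => /eqP cov tri non0.
rewrite -(@card_in_imset _ _ (fun z => pblock (blocks a) (i z))); last first.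
  move=> z w; rewrite !inE => /andP[/eqP z1 _] /andP[/eqP w1 _] /eqP.
  by rewrite -cs_rel_pblock -(bmin_eq _ _ ai) z1 w1 => /eqP/val_inj.
apply: eq_card => B; rewrite inE; apply/imsetP/andP => [[z]|[aB PB]].
  rewrite inE => /andP[/eqP z1 Pz] ->; split.
    by rewrite pblock_mem // cov inE.
  by rewrite -/(bmin a i (i z)) z1.
have /set0Pn[u uB] : B != set0 by apply: contraNneq non0 => <-.
have Bu := def_pblock tri aB uB.
have [z [uz az _]] := bminP u ai.
exists z; first by rewrite inE (bmin_min ai uz) eqxx -uz /bmin Bu.
by apply/eqP; rewrite -Bu -cs_rel_pblock.
Qed.

(** The rank is injective on the minima, which are as many as the blocks, and its values lie below
    that number; so every such value is taken. *)
Lemma brank_onto a i k : meets a i -> k < #|blocks a| ->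
  exists x, brank a i (i x) = k.
Proof.
move=> ai ka; pose M := [set z : 'I_n | bmin a i (i z) == z].
have cM : #|M| = #|blocks a|.
  have Ma : M = [set z : 'I_n | (bmin a i (i z) == z) && predT (val z)].
    by apply/setP => z; rewrite !inE andbT.
  by rewrite Ma (card_minima predT ai); apply: eq_card => B; rewrite inE andbT.
have lt z : z \in M -> brank a i (i z) < #|blocks a|.
  move=> zM; rewrite -cM; apply/proper_card/properP; split.
    by apply/subsetP => w; rewrite !inE => /andP[].
  exists z => //; move: zM; rewrite !inE => /eqP->.
  by rewrite ltnn andbF.
(* The bound on [k] makes the number of blocks a successor, as [inord] requires. *)
case: #|blocks a| ka cM lt => // m km cM lt.
pose f z : 'I_m.+1 := inord (brank a i (i z)).
have finj : {in M &, injective f}.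
  move=> z w zM wM /(congr1 val); rewrite /f /= !inordK ?lt // => /eqP.
  rewrite brank_eq // -(bmin_eq _ _ ai); move: zM wM; rewrite !inE.
  by move=> /eqP-> /eqP-> /eqP/val_inj.
have /eqP fM : f @: M == [set: 'I_m.+1].
  by rewrite eqEcard subsetT cardsT card_ord card_in_imset // cM leqnn.
have : inord k \in f @: M by rewrite fM inE.
case/imsetP=> z zM /(congr1 val); rewrite /f /= !inordK ?lt // => ->.
by exists z.
Qed.

Lemma brank_lt_card a i u : meets a i -> brank a i u < #|blocks a|.
Proof.
move=> ai; rewrite /brank (@card_minima a i (fun m => m < bmin a i u)) //.
apply/proper_card/properP; split.
  by apply/subsetP => B; rewrite inE => /andP[].
case/and3P: (blocksP a) => /eqP cov tri _.
exists (pblock (blocks a) u); first by rewrite pblock_mem // cov inE.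
by rewrite inE -/(bmin a i u) ltnn andbF.
Qed.

(** * Order-preserving elements in terms of minima and ranks *)

Lemma IOP_bminP (a : IP 'I_n) : reflect
  (forall u v, bmin a inl u <= bmin a inl v -> bmin a inr u <= bmin a inr v)
  (a \in IOP n).
Proof.
have up B : upper_part B = inl @^-1: B by apply/setP => x; rewrite !inE.
have lo B : lower_part B = inr @^-1: B by apply/setP => x; rewrite !inE.
case/and3P: (blocksP a) => /eqP cov tri non0.
have blk u : pblock (blocks a) u \in blocks a by rewrite pblock_mem // cov inE.
have rep B : B \in blocks a -> exists u, B = pblock (blocks a) u.
  move=> aB; have /set0Pn[u uB] : B != set0 by apply: contraNneq non0 => <-.
  by exists u; rewrite (def_pblock tri aB uB).
rewrite inE; apply: (iffP forall_inP) => [h u v uv|h B aB].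
  have /forall_inP/(_ _ (blk v))/implyP := h _ (blk u).
  by rewrite !up !lo; exact.
apply/forall_inP => C aC; apply/implyP; rewrite !up !lo.
by have [[u ->] [v ->]] := (rep _ aB, rep _ aC); exact: h.
Qed.

(** The converse implication is automatic: if it failed, the lower minima would be equal, so [u] and
    [v] would share a block and hence an upper minimum. *)
Lemma IOP_bmin_le (a : IP 'I_n) u v : a \in IOP n ->
  (bmin a inl u <= bmin a inl v) = (bmin a inr u <= bmin a inr v).
Proof.
move=> /IOP_bminP h; have [ai ar] := IP_meets (cs_of_IPP a).
apply/idP/idP => [|uv]; first exact: h.
rewrite leqNgt; apply/negP => vu; have le_vu := h _ _ (ltnW vu).
have /eqP eq_uv : bmin a inl u == bmin a inl v.
  by rewrite bmin_eq // -(bmin_eq _ _ ar) eqn_leq uv le_vu.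
by rewrite eq_uv ltnn in vu.
Qed.

(** The upper and lower minima order the blocks in the same way, so both ranks count the same
    blocks. *)
Lemma IOP_brank_eq (a : IP 'I_n) u : a \in IOP n ->
  brank a inl u = brank a inr u.
Proof.
move=> aO; have [al ar] := IP_meets (cs_of_IPP a).
rewrite /brank (@card_minima a inl (fun m => m < bmin a inl u)) //.
rewrite (@card_minima a inr (fun m => m < bmin a inr u)) //.
apply: eq_card => B; rewrite !inE.
case aB: (B \in blocks a) => //=.
case/and3P: (blocksP a) => _ tri non0.
have /set0Pn[v vB] : B != set0 by apply: contraNneq non0 => <-.
rewrite -(def_pblock tri aB vB) -/(bmin a inl v) -/(bmin a inr v).
by rewrite !ltnNge (IOP_bmin_le _ _ aO).
Qed.

(** By [eq_brank] the ranks depend only on the restrictions of [a] to the two copies; hence so do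
    the links between the copies. *)
Lemma IOP_rel (a : IP 'I_n) x y : a \in IOP n ->
  cs_rel a (inl x) (inr y) = (brank a inl (inl x) == brank a inr (inr y)).
Proof.
move=> aO; have [al ar] := IP_meets (cs_of_IPP a).
by rewrite -(IOP_brank_eq _ aO) brank_eq.
Qed.

(** * Uniqueness and existence in an H-class *)

Lemma eq_bmin a b i x :
  (forall y, cs_rel a (i x) (i y) = cs_rel b (i x) (i y)) ->
  bmin a i (i x) = bmin b i (i x).
Proof.
move=> ab; congr min_of.
by apply/setP => y; rewrite !inE -!cs_relE.
Qed.

Lemma eq_brank a b i x :
  (forall x y, cs_rel a (i x) (i y) = cs_rel b (i x) (i y)) ->
  brank a i (i x) = brank b i (i x).
Proof.
by move=> ab; apply: eq_card => z; rewrite !inE !(@eq_bmin a b).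
Qed.

Lemma IOP_greenH_uniq (a b : IP 'I_n) :
  a \in IOP n -> b \in IOP n -> greenH a b -> a = b.
Proof.
move=> aO bO [/greenR_IP abR /greenL_IP abL]; apply/val_inj/cs_eqP.
have mix x y : cs_rel a (inl x) (inr y) = cs_rel b (inl x) (inr y).
  by rewrite !IOP_rel // (eq_brank _ abR) (eq_brank _ abL).
case=> [x|x] [y|y]; [exact: abR|exact: mix| |exact: abL].
by rewrite cs_rel_sym [RHS]cs_rel_sym; exact: mix.
Qed.

Lemma IOP_greenH_ex (a : IP 'I_n) :
  exists2 t : IP 'I_n, t \in IOP n & greenH a t.
Proof.
have [al ar] := IP_meets (cs_of_IPP a).
(* Ranks on both sides fill the same range below the number of blocks, so the kernel of [r] joins
   each upper part of [a] to the lower part of equal rank. *)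
pose r u := match u with
  | inl x => brank a inl (inl x) | inr y => brank a inr (inr y) end.
have tIP : is_IP (cs_kernel r).
  apply/is_IPP; split=> z.
    have [y yz] := brank_onto ar (brank_lt_card (inl z) al).
    by exists y; rewrite cs_kernelE /= yz.
  have [x xz] := brank_onto al (brank_lt_card (inr z) ar).
  by exists x; rewrite cs_kernelE /= xz.
pose t := MkIP tIP.
have tR x y : cs_rel a (inl x) (inl y) = cs_rel t (inl x) (inl y).
  by rewrite cs_kernelE /= brank_eq.
have tL x y : cs_rel a (inr x) (inr y) = cs_rel t (inr x) (inr y).
  by rewrite cs_kernelE /= brank_eq.
exists t; last by split; [apply/greenR_IP|apply/greenL_IP].
have [tl tr] := IP_meets tIP.
apply/IOP_bminP => u v.
(* Representatives of the blocks of [u] and [v] on each side allow minima in [t] to be replaced by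
   minima in [a], then by ranks, which agree across each block of [t]. *)
have [[x [_ ux _]] [y [_ vy _]]] := (bminP u tl, bminP v tl).
have [[z [_ uz _]] [w [_ vw _]]] := (bminP u tr, bminP v tr).
move: (ux) (vy) (uz) (vw).
rewrite -(bmin_eq _ _ tl) -(bmin_eq _ _ tl) -(bmin_eq _ _ tr) -(bmin_eq _ _ tr).
move=> /eqP-> /eqP-> /eqP-> /eqP->.
rewrite -!(@eq_bmin a t) // -!brank_le //.
have rxz : r (inl x) == r (inr z).
  by rewrite -cs_kernelE; apply: cs_rel_trans uz; rewrite cs_rel_sym.
have ryw : r (inl y) == r (inr w).
  by rewrite -cs_kernelE; apply: cs_rel_trans vw; rewrite cs_rel_sym.
by move: rxz ryw => /= /eqP-> /eqP->.
Qed.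

(** * Closure under products *)

(* By compat, g and h are the upper and lower parts of a union of blocks. *)
Lemma IOP_saturated_min (a : IP 'I_n) g h x : a \in IOP n ->
  compat a g h -> g x ->
  exists u, bmin a inl u = min_of [set z | g z] /\
            bmin a inr u = min_of [set z | h z].
Proof.
move=> aO gh gx; have [al ar] := IP_meets (cs_of_IPP a).
have [|p] := @min_ofP n [set z | g z].
  by apply/set0Pn; exists x; rewrite inE.
rewrite inE => gp [-> pmin].
have [q0 pq0] := ar (inl p).
have [|q] := @min_ofP n [set z | h z].
  by apply/set0Pn; exists q0; rewrite inE -[h q0](gh _ _ pq0).
rewrite inE => hq [-> qmin].
have [p' [pp' rp gp']] := bminP (inl p) al.
have [q' [qq' rq _]] := bminP (inl p) ar.
have [z [qz rz _]] := bminP (inr q) al.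
have [w [qw _ wq]] := bminP (inr q) ar.
(* The block of [p] attains both minima. The block of [q] has its upper minimum at or above [p], so
   order preservation puts the lower minimum of the block of [p] at or below [q]. *)
exists (inl p); split.
  rewrite pp'; apply/eqP; rewrite eqn_leq gp' ?cs_rel_refl //=.
  by rewrite pmin // inE -[g p'](gh _ _ rp).
apply/eqP; rewrite eqn_leq; apply/andP; split; last first.
  by rewrite qq' qmin // inE -[h q'](gh _ _ rq).
apply: (@leq_trans (bmin a inr (inr q))).
  rewrite -IOP_bmin_le // qz pp'.
  apply: (@leq_trans p); first by rewrite gp' ?cs_rel_refl.
  by rewrite pmin // inE -[g z](gh _ _ rz).
by rewrite qw wq // cs_rel_refl.
Qed.

Lemma IOP_saturated_le (a : IP 'I_n) g h g' h' x x' :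
  a \in IOP n -> compat a g h -> compat a g' h' ->
  g x -> g' x' ->
  min_of [set z | g z] <= min_of [set z | g' z] ->
  min_of [set z | h z] <= min_of [set z | h' z].
Proof.
move=> aO gh gh' gx gx'.
have [u [<- <-]] := IOP_saturated_min aO gh gx.
have [v [<- <-]] := IOP_saturated_min aO gh' gx'.
exact/IOP_bminP.
Qed.

(** The comparison of minima travels from the upper copy to the middle one through [a], and on to
    the lower copy through [b]. *)
Lemma IOP_mul : mulg_closed (IOP n).
Proof.
move=> a b aO bO; apply/IOP_bminP => u v.
have [cl _] := IP_meets (cs_of_IPP (a * b)%g).
have [_ ar] := IP_meets (cs_of_IPP a).
pose g w z := cs_rel (a * b)%g w (inl z).
pose h w z := cs_rel (a * b)%g w (inr z).
have colE w z : colour (g w) (h w) z = cs_rel (a * b)%g w z by case: z.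
have gh w : compat (a * b)%g (g w) (h w).
  move=> y z yz; rewrite !colE; apply/idP/idP => wy.
    exact: cs_rel_trans wy yz.
  by apply: cs_rel_trans wy _; rewrite cs_rel_sym.
have gE w : bmin (a * b)%g inl w = min_of [set z | g w z].
  by congr min_of; apply/setP => z; rewrite !inE -cs_relE.
have hE w : bmin (a * b)%g inr w = min_of [set z | h w z].
  by congr min_of; apply/setP => z; rewrite !inE -cs_relE.
(* Here [k] marks the middle points along which the block of [w] is glued. The points [x] and [c]
   supply the nonemptiness required by [IOP_saturated_le] for [a] and for [b]. *)
have mid w : exists k, [/\ compat a (g w) k, compat b k (h w) &
    exists x c, g w x /\ k c].
  have [k [gk kh]] := (compat_mul a b (g w) (h w)).1 (gh w).
  exists k; split=> //; have [x wx] := cl w; have [c xc] := ar (inl x).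
  by exists x, c; split=> //; rewrite -[k c](gk _ _ xc).
have [k [gk kh [x [c [gx kc]]]]] := mid u.
have [k' [gk' kh' [x' [c' [gx' kc']]]]] := mid v.
rewrite !gE !hE => /(IOP_saturated_le aO gk gk' gx gx').
exact: IOP_saturated_le kh kh' kc kc'.
Qed.

End BlockMinima.

Theorem proposition12 (n : nat) : H_cross_section (IOP n).
Proof.
split; first exact: IOP_mul.
move=> C [a Ca]; have [t tO a_t] := IOP_greenH_ex a.
exists t; split=> [|s [sO /Ca a_s]]; first by split=> //; apply/Ca.
apply: IOP_greenH_uniq => //.
move: a_t a_s => [/greenR_IP tR /greenL_IP tL] [/greenR_IP sR /greenL_IP sL].
by split; [apply/greenR_IP|apply/greenL_IP] => x y; rewrite -?tR -?tL ?sR ?sL.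
Qed.
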